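(* Let $m,n$ be positive integers and let $\mathcal{P}(m,n)\subseteq\mathbb{R}^m$ be the convex hull of all words $u=u_1u_2\cdots u_m$ of length $m$ with entries in $\{0,1,\ldots,n\}$ whose nonzero entries are pairwise distinct. Then $\mathcal{P}(m,n)$ consists exactly of all vectors $u\in\mathbb{R}^m$ such that \[ \sum_{i\in S}u_i\le \binom{n+1}{2}-\binom{n-k+1}{2}\quad\text{for every } S\subseteq[m] \text{ with } |S|=k\neq 0, \] and $u_i\ge 0$ for all $1\le i\le m$.
   Context: $[m]=\{1,\ldots,m\}$. Words are regarded as vectors in $\mathbb{R}^m$. Binomial coefficients $\binom{a}{2}$ are taken to be $0$ whenever $a<2$ (including negative $a$). *)

(* Defs.v *)
From HB Require Import structures.
From mathcomp Require Import all_boot all_order all_algebra.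
From mathcomp Require Import boolp classical_sets reals convex.

Set Implicit Arguments.
Unset Strict Implicit.
Unset Printing Implicit Defensive.

Import Order.TTheory GRing.Theory Num.Theory.

Local Open Scope classical_set_scope.
Local Open Scope ring_scope.

Definition convex_hull (R : numDomainType) (E : lmodType R) (X : set E) :
    set E :=
  smallest (@convex_set R E) X.

Definition partial_perm_word (m n : nat) (w : m.-tuple 'I_n.+1) : Prop :=
  forall i j : 'I_m,
    tnth w i <> ord0 -> tnth w j <> ord0 -> tnth w i = tnth w j -> i = j.

Definition word_vector (R : realType) (m n : nat) (w : m.-tuple 'I_n.+1) :
    'rV[R]_m :=
  \row_i (tnth w i : nat)%:R.

Definition word_polytope (R : realType) (m n : nat) : set 'rV[R]_m :=
  convex_hull [set word_vector R w | w in @partial_perm_word m n].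

Arguments word_polytope R m n : clear implicits.

(* Main.v *)
(* Words satisfy the inequalities because the nonzero entries of a word are
   distinct, so removing the smallest of k entries costs at most n - k + 1.
   Conversely the hull C is invariant under permuting and under zeroing
   coordinates, so a point u may be assumed nonincreasing; the inequalities for
   initial segments then say that u is weakly majorized by the word
   (n, n-1, ..., 1, 0, ...), and finitely many transfers between two coordinates
   and decreases of one coordinate, all staying in C, turn this word into u. *)
Require Import Defs.
From mathcomp Require Import all_boot all_order all_algebra.
From mathcomp Require Import boolp classical_sets reals convex.
From HB Require Import structures.
From mathcomp Require Import fingroup perm interval_inference ring lra zify.

Set Implicit Arguments.
Unset Strict Implicit.

Import Order.TTheory GRing.Theory Num.Theory.
Local Open Scope classical_set_scope.
Local Open Scope ring_scope.

(** * Convex hulls and their linear images *)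

Lemma convex_setP (R : numDomainType) (E : lmodType R) (C : set E) :
  @convex_set R E C <->
  forall (t : R) x y, 0 <= t -> t <= 1 -> C x -> C y ->
    C (t *: x + (1 - t) *: y).
Proof.
split=> [cC t x y t0 t1 /mem_set Cx /mem_set Cy|cC x y t /set_mem Cx /set_mem Cy].
  by have /set_mem := cC x y (Itv01 t0 t1) Cx Cy.
by apply/mem_set; apply: (cC t%:num).
Qed.

Lemma convex_hull_convex (R : numDomainType) (E : lmodType R) (X : set E) :
  @convex_set R E (convex_hull X).
Proof.
apply/convex_setP=> t x y t0 t1 hx hy A [cA XA].
by apply: (proj1 (convex_setP _) cA) => //; [exact: hx|exact: hy].
Qed.

(** The preimage of the hull under a linear map is convex and contains [X], so minimality applies;
    symmetries of the hull need only be checked on words. *)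
Lemma convex_hull_image (R : numDomainType) (E : lmodType R) (X : set E)
    (f : {linear E -> E}) :
  (forall x, X x -> X (f x)) ->
  forall x, convex_hull X x -> convex_hull X (f x).
Proof.
move=> fX; apply: (@smallest_sub _ _ _ (f @^-1` convex_hull X)); last first.
  by move=> x Xx; apply: sub_gen_smallest; apply: fX.
apply/convex_setP => t x y t0 t1 hx hy /=; rewrite linearD !linearZ /=.
by apply: (proj1 (convex_setP _) (@convex_hull_convex R E X)).
Qed.

Definition set_coord (R : pzRingType) (m : nat) (i : 'I_m) (a : R)
    (v : 'rV[R]_m) : 'rV[R]_m :=
  \row_j (if j == i then a else v ord0 j).

Lemma set_coord0_is_linear (R : pzRingType) (m : nat) (i : 'I_m) :
  linear (@set_coord R m i 0).
Proof.
by move=> a x y; apply/rowP => j; rewrite !mxE; case: eqP; rewrite ?mulr0 ?addr0.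
Qed.

HB.instance Definition _ (R : pzRingType) (m : nat) (i : 'I_m) :=
  GRing.isLinear.Build R 'rV[R]_m 'rV[R]_m *:%R (@set_coord R m i 0)
    (@set_coord0_is_linear R m i).

(** * Weak majorization in a convex set closed under permuting and zeroing coordinates *)

Section WeakMajorization.
Context (R : realFieldType) (m : nat) (C : set 'rV[R]_m).
Hypothesis convexC : @convex_set R 'rV[R]_m C.
Hypothesis permC : forall (s : 'S_m) v, C v -> C (col_perm s v).
Hypothesis zeroC : forall (i : 'I_m) v, C v -> C (set_coord i 0 v).

Lemma set_coord_mem (i : 'I_m) (a : R) (v : 'rV[R]_m) :
  0 <= a -> a <= v ord0 i -> C v -> C (set_coord i a v).
Proof.
move=> a0 av Cv.
have -> : set_coord i a v =
    (a / v ord0 i) *: v + (1 - a / v ord0 i) *: set_coord i 0 v.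
  apply/rowP => j; rewrite !mxE; case: eqP => [->|_]; last by ring.
  (* If [v ord0 i] is 0, the bounds force [a = 0], so the identity survives whatever the quotient
     is. *)
  have [v0|v0] := eqVneq (v ord0 i) 0; last by field.
  by rewrite v0; move: av; rewrite v0; lra.
have v0 := le_trans a0 av.
apply: (proj1 (convex_setP C) convexC); rewrite ?divr_ge0 //; last exact: zeroC.
have [->|vN0] := eqVneq (v ord0 i) 0; first by rewrite invr0 mulr0.
by rewrite ler_pdivrMr ?mul1r // lt_neqAle eq_sym vN0.
Qed.

(** The new point lies on the segment from [y] to its image under the transposition of [j] and [k];
    the largest [d] gives the full swap. *)
Lemma transfer_mem (j k : 'I_m) (d : R) (y : 'rV[R]_m) :
  y ord0 k < y ord0 j -> 0 <= d -> d <= y ord0 j - y ord0 k -> C y ->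
  C (set_coord j (y ord0 j - d) (set_coord k (y ord0 k + d) y)).
Proof.
move=> kj d0 dle Cy.
set t := d / (y ord0 j - y ord0 k).
have nz : y ord0 j - y ord0 k != 0 by rewrite subr_eq0 gt_eqF.
have -> : set_coord j (y ord0 j - d) (set_coord k (y ord0 k + d) y) =
    t *: col_perm (tperm j k) y + (1 - t) *: y.
  apply/rowP => i; rewrite !mxE; case: tpermP => [->|->|/eqP/negbTE-> /eqP/negbTE->].
  - by rewrite eqxx /t; field.
  - rewrite eqxx; case: eqP => [e|_]; last by rewrite /t; field.
    by move: kj; rewrite e ltxx.
  - by ring.
apply: (proj1 (convex_setP C) convexC)=> //; last exact: permC.
- by rewrite divr_ge0 // subr_ge0 ltW.
- by rewrite ler_pdivrMr ?mul1r ?subr_gt0.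
Qed.

(* Hardy-Littlewood-Polya: each step moves mass from an entry of [y] exceeding
   that of [u] to the first entry below that of [u] (or, when there is none,
   shrinks an entry), and creates a new agreement between [y] and [u]. *)
Lemma weakly_majorized_mem (u y : 'rV[R]_m) :
  (forall i j : 'I_m, (i <= j)%N -> u ord0 j <= u ord0 i) ->
  (forall i, 0 <= u ord0 i) ->
  (forall l, (l <= m)%N ->
     \sum_(i < m | (i < l)%N) u ord0 i <= \sum_(i < m | (i < l)%N) y ord0 i) ->
  C y -> C u.
Proof.
move=> udec u0.
have [N] := ubnP #|[pred i | u ord0 i != y ord0 i]|.
elim: N y => // N IH y; rewrite ltnS => yN maj Cy.
have step (y' : 'rV[R]_m) (i0 : 'I_m) :
    u ord0 i0 != y ord0 i0 -> y' ord0 i0 = u ord0 i0 ->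
    (forall i, u ord0 i = y ord0 i -> y' ord0 i = y ord0 i) ->
    (#|[pred i | u ord0 i != y' ord0 i]| < N)%N.
  move=> ne0 e0 keep; apply: leq_trans yN; apply: proper_card.
  apply/fintype.properP; split; last by exists i0; rewrite !inE ?e0 ?eqxx.
  by apply/fintype.subsetP => i; rewrite !inE; apply: contra => /eqP e; rewrite keep ?e.
have [/existsP [k0 hk0]|/existsPn uy] := boolP [exists k, y ord0 k < u ord0 k];
  last first.
  have [/existsP [i0 ne0]|/existsPn e] := boolP [exists i, u ord0 i != y ord0 i];
    last first.
    by have -> : u = y by apply/rowP => i; move: (e i) => /negPn/eqP.
  apply: (IH (set_coord i0 (u ord0 i0) y)).
  - apply: (step _ i0) => //; first by rewrite mxE eqxx.
    by move=> i; rewrite mxE; case: eqP => // ->.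
  - move=> l _; apply: ler_sum => i _; rewrite mxE; case: eqP => [->|_] //.
    by rewrite leNgt uy.
  - by apply: set_coord_mem => //; rewrite leNgt uy.
have [k hk kmin] := @arg_minnP _ k0 (fun k => y ord0 k < u ord0 k) (@nat_of_ord m) hk0.
have below (i : 'I_m) : (i < k)%N -> u ord0 i <= y ord0 i.
  by move=> ik; rewrite leNgt; apply/negP => /kmin; rewrite leqNgt ik.
have [/existsP [j /andP [jk hj]]|/existsPn none] :=
    boolP [exists j : 'I_m, (j < k)%N && (u ord0 j < y ord0 j)]; last first.
  (* Without such a [j], [y] is at most [u] before [k] and strictly smaller at [k], against the
     prefix inequality ending at [k]. *)
  have := maj k.+1 (ltn_ord k); rewrite leNgt => /negP [].
  rewrite (bigD1 k) //= [ltRHS](bigD1 k) //= ltr_leD //.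
  apply: ler_sum => i /andP [ik nik]; rewrite leNgt; apply: contra (none i) => ->.
  by rewrite andbT ltn_neqAle -ltnS ik andbT.
have ujk := udec _ _ (ltnW jk).
have jNk : j != k by rewrite neq_ltn jk.
(* The largest transfer that overshoots neither target: whichever term is the minimum, that
   coordinate comes to agree with [u]. It is admissible since [y_k < u_k <= u_j < y_j]. *)
set d := Num.min (y ord0 j - u ord0 j) (u ord0 k - y ord0 k).
have dj : d <= y ord0 j - u ord0 j by rewrite ge_min lexx.
have dk : d <= u ord0 k - y ord0 k by rewrite ge_min lexx orbT.
have d0 : 0 <= d by rewrite le_min !subr_ge0 !ltW.
set y' := set_coord j (y ord0 j - d) (set_coord k (y ord0 k + d) y).
have y'j : y' ord0 j = y ord0 j - d by rewrite mxE eqxx.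
have y'k : y' ord0 k = y ord0 k + d by rewrite !mxE eq_sym (negbTE jNk) eqxx.
have y'N i : i != j -> i != k -> y' ord0 i = y ord0 i.
  by move=> /negbTE ij /negbTE ik; rewrite !mxE ij ik.
apply: (IH y'); last by apply: transfer_mem => //; lra.
  have keep i : u ord0 i = y ord0 i -> y' ord0 i = y ord0 i.
    by move=> e; apply: y'N; apply/eqP => ei; move: hj hk; rewrite -ei e ltxx.
  have [le|le] := leP (y ord0 j - u ord0 j) (u ord0 k - y ord0 k).
    apply: (step _ j) => //; first by rewrite lt_eqF.
    by rewrite y'j /d min_l //; ring.
  apply: (step _ k) => //; first by rewrite gt_eqF.
  by rewrite y'k /d min_r ?ltW //; ring.
(* A prefix ending before [k] is dominated termwise; one containing [k] also contains [j], so the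
   transfer preserves its sum. *)
move=> l lm; have [kl|lk] := ltnP k l; last first.
  apply: ler_sum => i il; have ik := leq_trans il lk.
  have [->|ij] := eqVneq i j; first by rewrite y'j; lra.
  by rewrite y'N ?below // neq_ltn ik.
have split (v : 'rV[R]_m) : \sum_(i < m | (i < l)%N) v ord0 i =
    v ord0 j + (v ord0 k + \sum_(i < m | ((i < l)%N && (i != j)) && (i != k)) v ord0 i).
  rewrite (bigD1 j) /=; last exact: ltn_trans kl.
  by rewrite (bigD1 k) //= kl eq_sym.
apply: le_trans (maj l lm) _; rewrite !split y'j y'k.
rewrite [X in _ <= _ + (_ + X)](eq_bigr (fun i => y ord0 i)); first by lra.
by move=> i /andP [/andP [_ ij] ik]; rewrite y'N.
Qed.

End WeakMajorization.

(** * The inequalities for words *)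

Lemma bin2_subS (n k : nat) : 'C(n.+1 - k, 2) = ('C(n.+1 - k.+1, 2) + (n - k))%N.
Proof.
rewrite subSS; have [kn|nk] := leqP k n; first by rewrite subSn // binS bin1.
by rewrite (eqP nk) (eqP (ltnW nk)).
Qed.

(** The word n, n-1, ... attains every prefix bound, even past its last nonzero entry, where entries
    and binomial are both 0. *)
Lemma sum_decreasing_word (n l : nat) :
  (\sum_(i < l) (n - i) + 'C(n.+1 - l, 2) = 'C(n.+1, 2))%N.
Proof.
elim: l => [|l IH]; first by rewrite big_ord0 subn0.
by rewrite big_ord_recr /= -addnA [X in (_ + X)%N]addnC -bin2_subS.
Qed.

Lemma partial_perm_word_sum (m n : nat) (w : m.-tuple 'I_n.+1) (S : {set 'I_m}) :
  partial_perm_word w ->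
  (\sum_(i in S) tnth w i + 'C(n.+1 - #|S|, 2) <= 'C(n.+1, 2))%N.
Proof.
move=> pw; move cS: #|S| => k; elim: k S cS => [|k IH] S cS.
  by rewrite subn0 (cards0_eq cS) big_set0.
have /card_gt0P [i0 Si0] : (0 < #|S|)%N by rewrite cS.
have [i Si imin] := @arg_minnP _ i0 [in S] (fun i => tnth w i) Si0.
have {}Si : i \in S by [].
have cSi : #|(S :\ i)%SET| = k by move: cS; rewrite (cardsD1 i) Si => -[].
have wi : (tnth w i <= n - k)%N.
  have [->|/eqP w0] := eqVneq (tnth w i) ord0; first by [].
  have wpos : (0 < tnth w i)%N.
    by rewrite lt0n; apply/negP => /eqP e; apply: w0; apply/val_inj.
  have nz j : j \in S -> tnth w j <> ord0.
    by move=> jS j0; have := imin j jS; rewrite j0 leqNgt wpos.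
  have inj : {in enum S &, injective (fun j => val (tnth w j))}.
    move=> a b; rewrite !mem_enum => aS bS /val_inj e.
    by apply: pw => //; apply: nz.
  have uq := enum_uniq (mem S); rewrite -(map_inj_in_uniq inj) in uq.
  (* The k + 1 distinct entries lie between the smallest one and [n], so k + 1 is at most
     [n.+1 - tnth w i]. *)
  have sub : {subset [seq val (tnth w j) | j <- enum S]
      <= iota (tnth w i) (n.+1 - tnth w i)}.
    move=> x /mapP [j]; rewrite mem_enum => jS ->.
    by rewrite mem_iota imin //= subnKC ?ltn_ord // ltnW.
  have := uniq_leq_size uq sub; rewrite size_map size_iota -cardE cS.
  have := ltn_ord (tnth w i); lia.
rewrite (big_setD1 i Si) /=.
apply: leq_trans (IH _ cSi).
by rewrite (bin2_subS n k) -addnA addnC -addnA !leq_add2l.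
Qed.

(** * Symmetries of the polytope, and sorting *)

Lemma word_polytope_perm (R : realType) (m n : nat) (s : 'S_m) (v : 'rV[R]_m) :
  word_polytope R m n v -> word_polytope R m n (col_perm s v).
Proof.
apply: (@convex_hull_image _ _ _ (col_perm s)) => _ [w pw <-].
exists [tuple tnth w (s i) | i < m].
  by move=> i j; rewrite !tnth_mktuple => wi wj e; apply/(perm_inj (s := s))/pw.
by apply/rowP => i; rewrite !mxE tnth_mktuple.
Qed.

Lemma word_polytope_set_coord0 (R : realType) (m n : nat) (i : 'I_m)
    (v : 'rV[R]_m) :
  word_polytope R m n v -> word_polytope R m n (set_coord i 0 v).
Proof.
apply: (@convex_hull_image _ _ _ (@set_coord R m i 0)) => _ [w pw <-].
exists [tuple if j == i then ord0 else tnth w j | j < m].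
  by move=> j k; rewrite !tnth_mktuple; do 2 case: eqP => // _; apply: pw.
by apply/rowP => j; rewrite !mxE tnth_mktuple; case: eqP.
Qed.

Lemma sort_row (R : realDomainType) (m : nat) (u : 'rV[R]_m) :
  exists s : 'S_m, forall i j : 'I_m, (i <= j)%N -> u ord0 (s j) <= u ord0 (s i).
Proof.
have /tuple_permP [s es] : perm_eq (sort >=%R [tuple u ord0 i | i < m])
    [tuple u ord0 i | i < m] by rewrite perm_sort.
exists s => i j ij.
have e (k : 'I_m) : nth 0 (sort >=%R [tuple u ord0 i | i < m]) k = u ord0 (s k).
  by rewrite es -(tnth_nth 0 _ k) !tnth_mktuple.
rewrite -!e; apply: (sorted_leq_nth (leT := >=%R)) => //.
- by move=> a b c ab bc; apply: le_trans bc ab.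
- by move=> a; apply: lexx.
- by apply: sort_sorted => a b; apply: le_total.
- by rewrite inE size_sort size_tuple.
- by rewrite inE size_sort size_tuple.
Qed.

(* The natural-number subtraction [n.+1 - k] is truncated at 0; since
   'C(0, 2) = 0, this is the convention that binomials of negative integers
   vanish.  The outer subtraction takes place in R. *)
Theorem theorem5p9 (R : realType) (m n : nat) (hm : (0 < m)%N) (hn : (0 < n)%N) :
  word_polytope R m n =
  [set u : 'rV[R]_m |
    (forall (S : {set 'I_m}) (k : nat), #|S| = k -> k <> 0%N ->
       \sum_(i in S) u ord0 i <= 'C(n.+1, 2)%:R - 'C(n.+1 - k, 2)%:R)
    /\ (forall i : 'I_m, 0 <= u ord0 i)].
Proof.
apply/seteqP; split.
  apply: smallest_sub.
    apply/convex_setP => t x y t0 t1 [hx x0] [hy y0]; split=> [S k cS kn0|i].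
      under eq_bigr do rewrite !mxE.
      rewrite big_split -!mulr_sumr /=.
      have := ler_wpM2l t0 (hx S k cS kn0).
      have t1' : 0 <= 1 - t by rewrite subr_ge0.
      have := ler_wpM2l t1' (hy S k cS kn0); lra.
    by rewrite !mxE addr_ge0 // mulr_ge0 // subr_ge0.
  move=> _ [w pw <-]; split=> [S k <- _|i]; last by rewrite mxE.
  under eq_bigr do rewrite mxE.
  by rewrite lerBrDr -natr_sum -natrD ler_nat partial_perm_word_sum.
move=> u [hu u0]; have [s us] := sort_row u.
suff Cs : word_polytope R m n (col_perm s u).
  have := @word_polytope_perm R m n (s^-1)%g _ Cs.
  by rewrite -col_permM mulVg col_perm1.
have zeroC := @word_polytope_set_coord0 R m.
have permC := @word_polytope_perm R m.
(* Truncated subtraction pads the word with zeros from index [n] on. *)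
pose w := [tuple inord (n - i) : 'I_n.+1 | i < m].
have wE (i : 'I_m) : tnth w i = (n - i)%N :> nat.
  by rewrite tnth_mktuple inordK // ltnS leq_subr.
apply: (weakly_majorized_mem (@convex_hull_convex _ _ _) (permC n) (zeroC n)
  (y := word_vector R w)).
- by move=> i j ij; rewrite !mxE us.
- by move=> i; rewrite mxE.
- move=> l lm; have [->|l0] := eqVneq l 0%N; first by rewrite !big_pred0_eq.
  under eq_bigr do rewrite mxE.
  under [leRHS]eq_bigr do rewrite mxE wE.
  rewrite -natr_sum -(big_ord_widen m (fun i => n - i)%N lm).
  have := sum_decreasing_word n l => /(congr1 (fun k => k%:R : R)).
  rewrite natrD => /(canRL (addrK _)) ->.
  (* The positions of the [l] largest entries of [u], so the inequality for [S] bounds the sorted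
     prefix. *)
  pose S := (s @: [set i : 'I_m | (i < l)%N])%SET.
  have cS : #|S| = l.
    rewrite card_imset; last exact: perm_inj.
    rewrite -sum1_card; under eq_bigl do rewrite inE.
    by rewrite -(big_ord_widen m (fun=> 1%N) lm) sum1_card card_ord.
  have := hu S l cS (elimN eqP l0).
  rewrite big_imset /=; last by move=> ? ? _ _; apply: perm_inj.
  by under eq_bigl do rewrite inE.
- apply: sub_gen_smallest; exists w => // i j.
  move=> wi wj /(congr1 val) /=; rewrite !wE => e; apply: val_inj => /=.
  have : (n - i)%N <> 0%N by rewrite -wE => e0; apply: wi; apply: val_inj.
  lia.
Qed.
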